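(* Let $c$ be continuous and satisfy (C1)–(C3). Let $0\le\overline h\in L^\infty(\mathbb{R}^d\times\mathbb{R}^d)$ have compact support and let $0\le f,g\in L^1_c(\mathbb{R}^d)$ with $\Gamma(f,g)^{\overline h}\ne\emptyset$. If $h\in\Gamma(f,g)^{\overline h}$ minimizes $I_c$ over $\Gamma(f,g)^{\overline h}$, then $h$ is geometrically extreme.
   Context: Cost assumptions: (C1) $c$ is bounded; (C2) there is a Lebesgue-negligible closed set $Z\subset\mathbb{R}^d\times\mathbb{R}^d$ with $c\in C^2((\mathbb{R}^d\times\mathbb{R}^d)\setminus Z)$; (C3) $\det D^2_{xy}c(x,y)\ne0$ for all $(x,y)\notin Z$, where $D^2_{xy}c=(\partial^2c/\partial x_i\partial y_j)_{i,j}$. $L^1_c$: integrable functions with compact support. $\Gamma(f,g)$: the $0\le h\in L^1_c(\mathbb{R}^d\times\mathbb{R}^d)$ with $\int h(x,y)dy=f(x)$ and $\int h(x,y)dx=g(y)$ a.e.; $\Gamma(f,g)^{\overline h}:=\{h\in\Gamma(f,g):h\le\overline h\text{ a.e.}\}$. $I_c(h):=\int c\,h\,dx\,dy$. A density $h\in\Gamma(f,g)^{\overline h}$ is geometrically extreme if there is a Lebesgue measurable $W\subset\mathbb{R}^{2d}$ with $h=\overline h\,1_W$ almost everywhere. *)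

(* Defs.v *)
From HB Require Import structures.
From mathcomp Require Import all_boot all_order all_algebra.
From mathcomp Require Import all_classical all_reals all_analysis.
Set Implicit Arguments.
Unset Strict Implicit.
Unset Printing Implicit Defensive.
Import Order.TTheory GRing.Theory Num.Theory.
Import numFieldNormedType.Exports.
Local Open Scope classical_set_scope.
Local Open Scope ring_scope.

(* The library only provides Lebesgue measure on R.  We build the n-fold     *)
(* product measure  lambda \x (lambda \x ( ... \x dirac)) on the nested      *)
(* product type  R * (R * ( ... * unit)), together with the canonical        *)
(* coordinate map from that type onto the row vectors 'rV[R]_n.               *)

(* The product of two sigma-finite measures, with its sigma-finite structure *)
(* (the library's generic instance is shadowed by the subprobability one).    *)
Section sfprod.
Local Open Scope ereal_scope.
Context d1 d2 (T1 : measurableType d1) (T2 : measurableType d2) (R : realType).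
Variable m1 : {sigma_finite_measure set T1 -> \bar R}.
Variable m2 : {sigma_finite_measure set T2 -> \bar R}.
Definition sfprod := (m1 \x m2)%E.
HB.instance Definition _ := Measure.on sfprod.
Lemma sfprod_sigma_finite : sigma_finite setT sfprod.
Proof.
have /sigma_finiteP[F [TF ndF Foo]] := sigma_finiteT m1.
have /sigma_finiteP[G [TG ndG Goo]] := sigma_finiteT m2.
exists (fun n => F n `*` G n).
 rewrite -setXTT TF TG predeqE => -[x y]; split.
    move=> [/= [n _ Fnx] [k _ Gky]]; exists (maxn n k) => //; split.
    - by move: x Fnx; exact/subsetPset/ndF/leq_maxl.
    - by move: y Gky; exact/subsetPset/ndG/leq_maxr.
  by move=> [n _ []/= ? ?]; split; exists n.
move=> k; have [? ?] := Foo k; have [? ?] := Goo k.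
split; first exact: measurableX.
by rewrite /sfprod product_measure1E// lte_mul_pinfty// ge0_fin_numE.
Qed.
HB.instance Definition _ := Measure_isSigmaFinite.Build _ _ _ sfprod sfprod_sigma_finite.
End sfprod.
Arguments sfprod {d1 d2 T1 T2 R}.

Record lebspace (R : realType) (n : nat) := LebSpace {
  ls_disp : measure_display;
  ls_type : measurableType ls_disp;
  ls_meas : {sigma_finite_measure set ls_type -> \bar R};
  ls_coord : ls_type -> 'rV[R]_n }.

Arguments ls_disp {R n} l.
Arguments ls_type {R n} l.
Arguments ls_meas {R n} l.
Arguments ls_coord {R n} l _.

Fixpoint leb_space (R : realType) (n : nat) : lebspace R n :=
  match n with
  | 0 => @LebSpace R 0 _ unit (\d_ tt) (fun _ => 0)
  | k.+1 => let S := leb_space R k in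
     @LebSpace R k.+1 _ (measurableTypeR R * ls_type S)%type
       (sfprod (@lebesgue_measure R) (ls_meas S))
       (fun p => \row_(i < k.+1)
          match unlift ord0 i with
          | None => p.1
          | Some j => ls_coord S p.2 ord0 j
          end)
  end.

Definition Rvec (R : realType) (n : nat) := 'rV[R]_n.
HB.instance Definition _ (R : realType) (n : nat) :=
  NormedModule.copy (Rvec R n) 'rV[R]_n.

(* Borel sigma-algebra on R^n: the image sigma-algebra of the (product)      *)
(* Borel sigma-algebra under the coordinate bijection.                       *)
Definition Rvec_measurable (R : realType) (n : nat) (A : set (Rvec R n)) :=
  measurable (ls_coord (leb_space R n) @^-1` A).

Lemma Rvec_measurable0 (R : realType) (n : nat) : Rvec_measurable (@set0 (Rvec R n)).
Proof. by rewrite /Rvec_measurable preimage_set0; exact: measurable0. Qed.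

Lemma Rvec_measurableC (R : realType) (n : nat) (A : set (Rvec R n)) :
  Rvec_measurable A -> Rvec_measurable (~` A).
Proof. by rewrite /Rvec_measurable preimage_setC => mA; exact: measurableC. Qed.

Lemma Rvec_measurableU (R : realType) (n : nat) (F : (set (Rvec R n))^nat) :
  (forall i, Rvec_measurable (F i)) -> Rvec_measurable (\bigcup_i F i).
Proof. by rewrite /Rvec_measurable preimage_bigcup => mF; exact: bigcupT_measurable. Qed.

HB.instance Definition _ (R : realType) (n : nat) :=
  @isMeasurable.Build default_measure_display (Rvec R n) (@Rvec_measurable R n)
    (@Rvec_measurable0 R n) (@Rvec_measurableC R n) (@Rvec_measurableU R n).

Lemma measurable_coord (R : realType) (n : nat) :
  measurable_fun [set: ls_type (leb_space R n)]
    (ls_coord (leb_space R n) : _ -> Rvec R n).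
Proof. by move=> _ A mA; rewrite setTI. Qed.

Definition lebRn (R : realType) (n : nat) : set (Rvec R n) -> \bar R :=
  pushforward (ls_meas (leb_space R n)) (ls_coord (leb_space R n) : _ -> Rvec R n).

Arguments lebRn R n _ : clear implicits.

HB.instance Definition _ (R : realType) (n : nat) :=
  Measure.copy (lebRn R n)
    (measure_function_pushforward__canonical__measure_function_Measure
       (ls_meas (leb_space R n)) (@measurable_coord R n)).

Lemma measurable_coord2 (R : realType) (n : nat) :
  measurable_fun [set: (ls_type (leb_space R n) * ls_type (leb_space R n))%type]
    (fun p => (ls_coord (leb_space R n) p.1 : Rvec R n,
               ls_coord (leb_space R n) p.2 : Rvec R n)).
Proof.
apply: measurable_fun_pair.
- exact: (measurableT_comp (@measurable_coord R n) measurable_fst).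
- exact: (measurableT_comp (@measurable_coord R n) measurable_snd).
Qed.

Definition lebR2n (R : realType) (n : nat) :
    set (Rvec R n * Rvec R n)%type -> \bar R :=
  pushforward (sfprod (ls_meas (leb_space R n)) (ls_meas (leb_space R n)))
    (fun p => (ls_coord (leb_space R n) p.1 : Rvec R n,
               ls_coord (leb_space R n) p.2 : Rvec R n)).

Arguments lebR2n R n _ : clear implicits.

HB.instance Definition _ (R : realType) (n : nat) :=
  Measure.copy (lebR2n R n)
    (measure_function_pushforward__canonical__measure_function_Measure
       (sfprod (ls_meas (leb_space R n)) (ls_meas (leb_space R n)))
       (@measurable_coord2 R n)).

Section statement_defs.
Variables (R : realType) (d : nat).

Local Notation X := (Rvec R d).
Local Notation P := (Rvec R d * Rvec R d)%type.

Definition dir_x (i : 'I_d) : P := (delta_mx 0 i : X, 0 : X).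
Definition dir_y (j : 'I_d) : P := (0 : X, delta_mx 0 j : X).
Definition coord_dirs : set P := [set u | exists i, u = dir_x i \/ u = dir_y i].

Definition C2_on (U : set P) (f : P -> R) : Prop :=
  forall p, U p ->
    [/\ {for p, continuous f},
        forall u, coord_dirs u -> derivable f p u /\ {for p, continuous ('D_u f)}
      & forall u v, coord_dirs u -> coord_dirs v ->
          derivable ('D_u f) p v /\ {for p, continuous ('D_v ('D_u f))}].

Definition mixed_hessian (f : P -> R) (p : P) : 'M[R]_d :=
  \matrix_(i, j) ('D_(dir_x i) ('D_(dir_y j) f)) p.

(* Lebesgue measurability in R^d x R^d (measurability for the completion of *)
(* the Lebesgue measure): W differs from a Borel set by a null set.          *)
Definition leb_measurable (W : set P) : Prop :=
  exists B, measurable B /\ (lebR2n R d).-negligible ((W `\` B) `|` (B `\` W)).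

Definition L1c_Rd (f : X -> R) : Prop :=
  (lebRn R d).-integrable setT (EFin \o f) /\
  exists K : set X, compact K /\ {ae lebRn R d, forall x, ~ K x -> f x = 0}.

Definition L1c_R2d (h : P -> R) : Prop :=
  (lebR2n R d).-integrable setT (EFin \o h) /\
  exists K : set P, compact K /\ {ae lebR2n R d, forall p, ~ K p -> h p = 0}.

Definition Linfty_c_R2d (h : P -> R) : Prop :=
  measurable_fun setT h /\
  (exists M : R, {ae lebR2n R d, forall p, `|h p| <= M}) /\
  exists K : set P, compact K /\ {ae lebR2n R d, forall p, ~ K p -> h p = 0}.

Definition Gamma (f g : X -> R) (h : P -> R) : Prop :=
  [/\ {ae lebR2n R d, forall p, 0 <= h p},
      L1c_R2d h,
      {ae lebRn R d, forall x, (\int[lebRn R d]_y (h (x, y))%:E)%E = (f x)%:E}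
    & {ae lebRn R d, forall y, (\int[lebRn R d]_x (h (x, y))%:E)%E = (g y)%:E}].

Definition Gamma_bar (f g : X -> R) (hbar : P -> R) (h : P -> R) : Prop :=
  Gamma f g h /\ {ae lebR2n R d, forall p, h p <= hbar p}.

Definition Ic (c : P -> R) (h : P -> R) : \bar R :=
  (\int[lebR2n R d]_p (c p * h p)%:E)%E.

Definition geom_extreme (hbar : P -> R) (h : P -> R) : Prop :=
  exists W : set P, leb_measurable W /\
    {ae lebR2n R d, forall p, h p = hbar p * \1_W p}.

End statement_defs.

(* Main.v *)
(* Suppose h takes values strictly between 0 and hbar on a set of positive
   measure.  Then for some delta > 0, some entry of the mixed Hessian and some
   ball B on which that entry has a constant sign, the set E of points of B with
   delta <= h <= hbar - delta has positive measure.  Translates of E by small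
   multiples of a coordinate vector cannot be pairwise disjoint, so, applying
   this first in x and then in y, there are u = (t e_i, 0) and v = (0, r e_j),
   with t, r > 0, and a set G of positive measure such that p, p + u, p + v and
   p + u + v lie in E for all p in G.  Moving mass kappa from G + u and G + v to
   G and G + u + v (with a small kappa of either sign) preserves the marginals and the
   constraints, and changes the cost by
     kappa \int_G (c(p) - c(p + u) - c(p + v) + c(p + u + v)) dp.
   By the mean value theorem the integrand is t r times a value of the chosen
   mixed derivative in B, so the right sign of kappa lowers the cost. *)
Require Import Defs.
From HB Require Import structures.
From mathcomp Require Import all_boot all_order all_algebra.
From mathcomp Require Import all_classical all_reals all_analysis.
From mathcomp Require Import measurable_realfun ring lra.
Import Order.TTheory GRing.Theory Num.Theory.
Import numFieldNormedType.Exports.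
Local Open Scope classical_set_scope.
Local Open Scope ring_scope.

(** * Translation invariance of Lebesgue measure, built up factor by factor *)

(** The pushforward of the product measure agrees with it on measurable rectangles, and a product
    measure is determined by these. *)
Lemma sfprod_measure_preserving {d1 d2 : measure_display} {T1 : measurableType d1}
    {T2 : measurableType d2} {R : realType}
    {m1 : {sigma_finite_measure set T1 -> \bar R}}
    {m2 : {sigma_finite_measure set T2 -> \bar R}} {t1 : T1 -> T1} {t2 : T2 -> T2} :
  measurable_fun setT t1 -> measurable_fun setT t2 ->
  (forall A, measurable A -> m1 (t1 @^-1` A) = m1 A) ->
  (forall A, measurable A -> m2 (t2 @^-1` A) = m2 A) ->
  forall A, measurable A ->
    sfprod m1 m2 ((fun p => (t1 p.1, t2 p.2)) @^-1` A) = sfprod m1 m2 A.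
Proof.
move=> mt1 mt2 inv1 inv2.
have mt : measurable_fun setT (fun p : T1 * T2 => (t1 p.1, t2 p.2)).
  by apply: measurable_fun_pair; [exact: (measurableT_comp mt1 measurable_fst)|
                                  exact: (measurableT_comp mt2 measurable_snd)].
move=> A mA; apply/esym.
rewrite /sfprod (@product_measure_unique _ _ _ _ _ m1 m2
  (measure_function_pushforward__canonical__measure_function_Measure
     (sfprod m1 m2) mt)) // => B C mB mC.
rewrite /= /pushforward.
rewrite (_ : _ @^-1` _ = (t1 @^-1` B) `*` (t2 @^-1` C)) //.
have mpre d (T : measurableType d) (t : T -> T) D :
    measurable_fun setT t -> measurable D -> measurable (t @^-1` D).
  by move=> mf mD; rewrite -[X in measurable X]setTI; exact: mf.
rewrite /sfprod product_measure1E; [|exact: mpre|exact: mpre].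
by congr (_ * _)%E; [exact: inv1|exact: inv2].
Qed.

(** Lebesgue measure is determined by its values on half-open intervals, whose lengths are unchanged
    by translation. *)
Lemma lebesgue_measure_translate (R : realType) (a : R) (A : set (measurableTypeR R)) :
  measurable A ->
  lebesgue_measure ((fun x : measurableTypeR R => x + a : measurableTypeR R) @^-1` A)
  = lebesgue_measure A.
Proof.
have mt : measurable_fun setT (fun x : measurableTypeR R => x + a : measurableTypeR R).
  by apply: measurable_funD.
move=> mA; apply/esym.
rewrite (@lebesgue_measure_unique R
  (measure_function_pushforward__canonical__measure_function_Measure
     (@lebesgue_measure R) mt)) // => _ [[b c]] _ <-.
rewrite /= /pushforward.
rewrite (_ : _ @^-1` _ = `]b - a, c - a]%classic); last first.
  by apply/seteqP; split => x /=; rewrite !in_itv /= ltrBlDr lerBrDr.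
by rewrite !lebesgue_measure_itv /= !lte_fin ltrD2r !EFinN -!EFinD opprB addrA subrK.
Qed.

Section coordinates.
Context {R : realType}.

(** Translation by [v] read on the nested product, where it acts on each factor separately; this
    lets measurability and invariance go by induction on [n]. *)
Fixpoint ls_shift (n : nat) :
    'rV[R]_n -> ls_type (leb_space R n) -> ls_type (leb_space R n) :=
  match n with
  | 0 => fun _ t => t
  | k.+1 => fun v t =>
      (t.1 + v ord0 ord0, ls_shift k (\row_j v ord0 (lift ord0 j)) t.2)
  end.

Lemma ls_coord_shift n (v : 'rV[R]_n) t :
  ls_coord (leb_space R n) (ls_shift n v t) = ls_coord (leb_space R n) t + v.
Proof.
elim: n v t => [|n IH] v t; first by apply/rowP => -[].
apply/rowP => i; rewrite /= !mxE.
by case: unliftP => [j|] -> //; rewrite IH !mxE.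
Qed.

Lemma measurable_ls_shift n (v : 'rV[R]_n) : measurable_fun setT (ls_shift n v).
Proof.
elim: n v => [|n IH] v /=; first exact: measurable_id.
apply: measurable_fun_pair; last exact: (measurableT_comp (IH _) measurable_snd).
by apply: measurable_funD; [exact: measurable_fst|exact: measurable_cst].
Qed.

Lemma ls_meas_shift n (v : 'rV[R]_n) A : measurable A ->
  ls_meas (leb_space R n) (ls_shift n v @^-1` A) = ls_meas (leb_space R n) A.
Proof.
elim: n v A => [|n IH] v A //= mA.
apply: (@sfprod_measure_preserving _ _ _ _ R (@lebesgue_measure R) (ls_meas (leb_space R n))
  (fun x : measurableTypeR R => x + v ord0 ord0 : measurableTypeR R)
  (ls_shift n (\row_j v ord0 (lift ord0 j)))) mA.
- by apply: measurable_funD; [exact: measurable_id|exact: measurable_cst].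
- exact: measurable_ls_shift.
- exact: lebesgue_measure_translate.
- exact: IH.
Qed.

Lemma lebRn_shift n (v : Rvec R n) (A : set (Rvec R n)) : measurable A ->
  lebRn R n (shift v @^-1` A) = lebRn R n A.
Proof.
move=> mA; rewrite /lebRn /pushforward /= -[RHS](ls_meas_shift _ v) //.
by congr (ls_meas _ _); apply/seteqP; split => t /=; rewrite ls_coord_shift.
Qed.

Lemma lebR2n_shift n (w : Rvec R n * Rvec R n) (A : set (Rvec R n * Rvec R n)) :
  measurable A -> lebR2n R n (shift w @^-1` A) = lebR2n R n A.
Proof.
move=> mA; rewrite /lebR2n /pushforward /=.
rewrite -[RHS](sfprod_measure_preserving (measurable_ls_shift _ w.1)
                (measurable_ls_shift _ w.2) (ls_meas_shift _ w.1) (ls_meas_shift _ w.2)).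
  by congr (sfprod _ _ _); apply/seteqP; split => t /=; rewrite /= !ls_coord_shift.
by rewrite -[X in measurable X]setTI; exact: measurable_coord2.
Qed.

(** A set in [Rvec R n] is measurable when its preimage under [ls_coord] is, and on the nested
    product an entry is an iterated projection. *)
Lemma measurable_entry n (i : 'I_n) :
  measurable_fun setT (fun x : Rvec R n => x ord0 i).
Proof.
move=> _ B mB; rewrite setTI.
change (measurable ((fun t => ls_coord (leb_space R n) t ord0 i) @^-1` B)).
suff: measurable_fun setT (fun t => ls_coord (leb_space R n) t ord0 i).
  by move=> /(_ measurableT B mB); rewrite setTI.
elim: n i {B mB} => [[]//|n IH] i.
case: (unliftP ord0 i) => [j|] ->.
  apply: (eq_measurable_fun (fun t => ls_coord (leb_space R n) t.2 ord0 j)).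
    by move=> t _ /=; rewrite mxE liftK.
  exact: (measurableT_comp (IH j) measurable_snd).
apply: (eq_measurable_fun fst); last exact: measurable_fst.
by move=> t _ /=; rewrite mxE unlift_none.
Qed.

Lemma measurable_shift n (v : Rvec R n) :
  measurable_fun setT (shift v).
Proof.
move=> _ A mA; rewrite setTI.
change (measurable (ls_coord (leb_space R n) @^-1` (shift v @^-1` A))).
have := measurable_ls_shift n v measurableT _ mA; rewrite setTI.
by congr measurable; apply/seteqP; split => t /=; rewrite ls_coord_shift.
Qed.

Lemma measurable_shift_pair n (w : Rvec R n * Rvec R n) :
  measurable_fun setT (shift w).
Proof.
by apply: measurable_fun_pair; [exact: (measurableT_comp (measurable_shift n w.1) measurable_fst)|
                                exact: (measurableT_comp (measurable_shift n w.2) measurable_snd)].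
Qed.

End coordinates.

(** * Balls of the max norm, and a countable base made of rational balls *)

Section boxes.
Context {R : realType}.

(** Positivity of [e] is part of the definition of a ball of matrices; in dimension 0 the entrywise
    bounds alone would not give it. *)
Lemma ball_RvecP {n} {x y : Rvec R n} {e : R} : 0 < e ->
  ball x e y <-> forall i, `|x ord0 i - y ord0 i| < e.
Proof.
move=> e0; split=> [[_ xy] i|xy]; first exact: xy.
by split=> // i j; rewrite (ord1 i); exact: xy.
Qed.

Lemma measurable_ball_Rvec n (x : Rvec R n) (e : R) :
  measurable (ball x e : set (Rvec R n)).
Proof.
have [e0|e0] := ltP 0 e; last first.
  rewrite (_ : ball x e = set0) //; apply/seteqP; split => // y [].
  by rewrite ltNge e0.
rewrite (_ : ball x e = \bigcap_(i in [set: 'I_n])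
    ((fun y : Rvec R n => y ord0 i) @^-1` ball (x ord0 i) e)).
  apply: fin_bigcap_measurable => // i _.
  rewrite -[X in measurable X]setTI; apply: measurable_entry => //.
  exact: measurable_ball.
by apply/seteqP; split => y; [move/(ball_RvecP e0) => xy i _; exact: xy|
   move=> xy; apply/(ball_RvecP e0) => i; exact: xy].
Qed.

Lemma measurable_ball_pair n (p : Rvec R n * Rvec R n) (e : R) :
  measurable (ball p e : set (Rvec R n * Rvec R n)).
Proof.
rewrite (_ : ball p e = ball p.1 e `*` ball p.2 e) //.
by apply: measurableX; exact: measurable_ball_Rvec.
Qed.

Lemma measurable_coord_ball n (x : Rvec R n) (e : R) :
  measurable (ls_coord (leb_space R n) @^-1` (ball x e : set (Rvec R n))).
Proof.
by rewrite -[X in measurable X]setTI; apply: measurable_coord => //; exact: measurable_ball_Rvec.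
Qed.

(** In coordinates a ball is an interval times a ball of one dimension less. In dimension 0 the
    measure is a Dirac mass, of total mass 1. *)
Lemma lebRn_ball_lty {n} (x : Rvec R n) {e : R} : 0 < e -> (lebRn R n (ball x e) < +oo)%E.
Proof.
move=> e0.
suff: (ls_meas (leb_space R n) (ls_coord (leb_space R n) @^-1` (ball x e : set (Rvec R n))) < +oo)%E by [].
elim: n x => [|n IH] x.
  by rewrite /= (_ : _ @^-1` _ = setT) ?diracT ?ltry //; apply/seteqP; split => // t _; split => // ? [].
pose x' : Rvec R n := \row_j x ord0 (lift ord0 j).
rewrite (_ : _ @^-1` _ = (ball (x ord0 ord0) e : set (measurableTypeR R)) `*`
   (ls_coord (leb_space R n) @^-1` (ball x' e : set (Rvec R n)))); last first.
  apply/seteqP; split => [[a t] /(ball_RvecP e0) xt|[a t] [/= xa /(ball_RvecP e0) xt]].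
    split=> /=; first by have := xt ord0; rewrite mxE unlift_none.
    by apply/(ball_RvecP e0) => i; have := xt (lift ord0 i); rewrite !mxE liftK.
  apply/(ball_RvecP e0) => i.
  by rewrite mxE; case: unliftP => [j|] -> //; have := xt j; rewrite mxE.
rewrite /= /sfprod product_measure1E; [|exact: measurable_ball|exact: measurable_coord_ball].
have finB : lebesgue_measure (ball (x ord0 ord0) e) \is a fin_num.
  by rewrite lebesgue_measure_ball // ltW.
by rewrite lte_mul_pinfty.
Qed.

Lemma lebR2n_ball_lty {n} (p : Rvec R n * Rvec R n) {e : R} : 0 < e ->
  (lebR2n R n (ball p e) < +oo)%E.
Proof.
move=> e0; rewrite /lebR2n /pushforward /=.
rewrite (_ : _ @^-1` _ =
   (ls_coord (leb_space R n) @^-1` (ball p.1 e : set (Rvec R n))) `*`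
   (ls_coord (leb_space R n) @^-1` (ball p.2 e : set (Rvec R n)))) //.
rewrite /sfprod product_measure1E; [|exact: measurable_coord_ball|exact: measurable_coord_ball].
rewrite lte_mul_pinfty //; last exact: (lebRn_ball_lty _ e0).
by rewrite ge0_fin_numE //; exact: (lebRn_ball_lty _ e0).
Qed.

Lemma ball_rat_Rvec {n} (x : Rvec R n) {e : R} : 0 < e ->
  exists q : 'rV[rat]_n, ball (map_mx ratr q : Rvec R n) e x.
Proof.
move=> e0.
have /choice[q qx] : forall i, exists q : rat, `|ratr q - x ord0 i| < e.
  move=> i; have /rat_in_itvoo[q] : x ord0 i - e < x ord0 i + e.
    by rewrite ltrBlDr -addrA ltrDl addr_gt0.
  by rewrite in_itv /= -ltr_distl; exists q.
exists (\row_i q i); apply/(ball_RvecP e0) => i; rewrite !mxE; exact: qx.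
Qed.

(** An enumeration of the balls with rational centre and radius [1/(k+1)]. An [m] that codes nothing
    gets the default code, so every index yields a ball of positive radius. *)
Definition ratball n (m : nat) : set (Rvec R n * Rvec R n) :=
  let: (q, k) := odflt (0, 0, 0%N) (unpickle m : option ('rV[rat]_n * 'rV[rat]_n * nat)) in
  ball (map_mx ratr q.1 : Rvec R n, map_mx ratr q.2 : Rvec R n) k.+1%:R^-1.

Lemma ratballE n m : exists (p : Rvec R n * Rvec R n) (e : R), 0 < e /\ ratball n m = ball p e.
Proof. by rewrite /ratball; case: (odflt _ _) => [[q1 q2] k]; eexists; exists k.+1%:R^-1. Qed.

Lemma nbhs_ratball {n} {U : set (Rvec R n * Rvec R n)} {p} : nbhs p U ->
  exists m, ratball n m p /\ ratball n m `<=` U.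
Proof.
move=> /nbhs_ballP[e /= e0 eU].
(* With radius below [e / 2] and centre within that radius of [p], the triangle inequality keeps the
   ball inside [ball p e]. *)
have [k] : exists k, 0 + k.+1%:R^-1 < e / 2 by apply: ltr_add_invr; rewrite divr_gt0.
rewrite add0r => ke; have k0 : 0 < k.+1%:R^-1 :> R by [].
have [q1 q1p] := ball_rat_Rvec p.1 k0; have [q2 q2p] := ball_rat_Rvec p.2 k0.
exists (pickle ((q1, q2), k)); rewrite /ratball pickleK /=; split; first by split.
move=> x qx; apply: eU; rewrite (splitr e).
apply: ball_triangle (le_ball (ltW ke) qx).
by apply: ball_sym; apply: (le_ball (ltW ke)); split.
Qed.

Lemma measurable_ratball n m : measurable (ratball n m).
Proof. by have [p [e [_ ->]]] := ratballE n m; exact: measurable_ball_pair. Qed.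

Lemma open_bigcup_ratball {n} {U : set (Rvec R n * Rvec R n)} : open U ->
  U = \bigcup_(m in [set m | ratball n m `<=` U]) ratball n m.
Proof.
move=> oU; apply/seteqP; split => [p Up|p [m /= mU mp]]; last exact: mU.
have [m [mp mU]] := nbhs_ratball (open_nbhs_nbhs (conj oU Up)).
by exists m.
Qed.

(** The sigma-algebra here is the product one, so open sets must first be written as countable
    unions of rational balls. *)
Lemma continuous_measurable_pair {n} {F : Rvec R n * Rvec R n -> R} :
  continuous F -> measurable_fun setT F.
Proof.
move=> /continuousP cF; apply: (measurability _ (RGenOpens.measurableE R)).
move=> _ [_ [a [b ->] <-]]; rewrite setTI.
rewrite (open_bigcup_ratball (cF _ (interval_open _ _))) //.
by apply: bigcup_measurable => m _; exact: measurable_ratball.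
Qed.

End boxes.

(** * Almost disjoint unions, measure-preserving maps, and recurrence under translations *)

Section null_intersections.
Local Open Scope ereal_scope.
Context {d : measure_display} {T : measurableType d} {R : realType}.
Variable mu : {measure set T -> \bar R}.

Lemma measureU_null (A B : set T) : measurable A -> measurable B ->
  mu (A `&` B) = 0 -> mu (A `|` B) = mu A + mu B.
Proof.
move=> mA mB AB0.
have -> : A `|` B = A `|` (B `\` A).
  apply/seteqP; split => x /=; last by move=> [Ax|[Bx _]]; [left|right].
  by have [Ax|Ax] := pselect (A x); [left|move=> [//|Bx]; right].
rewrite measureU //; last 2 first.
- exact: measurableD.
- by rewrite setDE setICA setICr setI0.
by congr (_ + _); rewrite [RHS](measureDI mu mB mA) [X in _ = _ + X](_ : _ = 0) ?adde0 // setIC.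
Qed.

(** By induction: the overlap of [F n] with the preceding union is a finite union of null sets. *)
Lemma measure_bigsetU_null (F : (set T)^nat) (n : nat) :
  (forall k, measurable (F k)) ->
  (forall j k, (j < k)%N -> mu (F j `&` F k) = 0) ->
  mu (\big[setU/set0]_(i < n) F i) = \sum_(i < n) mu (F i).
Proof.
move=> mF F0; elim: n => [|n IH]; first by rewrite !big_ord0 measure0.
rewrite !big_ord_recr /= -IH measureU_null //; first exact: bigsetU_measurable.
rewrite big_distrl /=; apply/negligibleP.
  by apply: bigsetU_measurable => i _; exact: measurableI.
apply: (big_ind (fun A => mu.-negligible A)).
- exact: negligible_set0.
- by move=> A B nA nB; exact: negligibleU.
- by move=> i _; apply/negligibleP; [exact: measurableI|exact: F0].
Qed.

End null_intersections.

Section measure_preserving.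
Local Open Scope ereal_scope.
Context {d : measure_display} {T : measurableType d} {R : realType}.
Context {mu : {measure set T -> \bar R}} {t : T -> T}.
Hypothesis mt : measurable_fun setT t.
Hypothesis mu_t : forall A, measurable A -> mu (t @^-1` A) = mu A.

Lemma integrable_measure_preserving (F : T -> \bar R) :
  mu.-integrable setT F -> mu.-integrable setT (F \o t).
Proof.
move=> /integrableP[mF iF]; apply/integrableP; split; first exact: measurableT_comp.
apply: le_lt_trans iF.
rewrite -[X in X <= _](@ge0_integral_pushforward _ _ _ _ R t mt mu setT (abse \o F)) //.
  rewrite le_eqVlt; apply/orP; left; apply/eqP.
  by apply: eq_measure_integral => A mA _; exact: mu_t.
- exact: measurableT_comp.
- by move=> x _; exact: abse_ge0.
Qed.

Lemma integral_measure_preserving (F : T -> \bar R) :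
  mu.-integrable setT F -> \int[mu]_x F (t x) = \int[mu]_x F x.
Proof.
move=> iF.
rewrite -[LHS](@integral_pushforward _ _ _ _ R t mt mu setT F) //.
- by apply: eq_measure_integral => A mA _; exact: mu_t.
- by have /integrableP[] := iF.
- exact: integrable_measure_preserving.
Qed.

End measure_preserving.

(* The translates [E + w/(k+1)] all have the measure of [E] and stay in one
   ball, so they cannot be pairwise almost disjoint. *)
Lemma recurrence {R : realType} {n : nat} (w p : Rvec R n * Rvec R n) (e : R)
    (E : set (Rvec R n * Rvec R n)) :
  0 < e -> measurable E -> E `<=` ball p e -> (0 < lebR2n R n E)%E ->
  exists2 t : R, 0 < t & (0 < lebR2n R n (E `&` shift (t *: w) @^-1` E))%E.
Proof.
move=> e0 mE Ee E0; apply: contrapT => noret.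
have ret0 t : 0 < t -> lebR2n R n (E `&` shift (t *: w) @^-1` E) = 0%E.
  move=> t0; apply/eqP; rewrite -measure_le0 leNgt; apply/negP => Et.
  by apply: noret; exists t.
have mS (v : Rvec R n * Rvec R n) (A : set (Rvec R n * Rvec R n)) :
      measurable A -> measurable (shift v @^-1` A).
  by move=> mA; rewrite -[X in measurable X]setTI; exact: measurable_shift_pair.
(* As the preimage of [E] under a shift by [- w/(k+1)], this is the translate [E + w/(k+1)]. *)
pose F k := shift (- (k.+1%:R^-1 *: w)) @^-1` E.
have mF k : measurable (F k) by exact: mS.
have FE k : lebR2n R n (F k) = lebR2n R n E by exact: lebR2n_shift.
have F0 j k : (j < k)%N -> lebR2n R n (F j `&` F k) = 0%E.
  (* [F j] meets [F k] in the translate by [w/(j+1)] of the set of points of [E] that return to [E]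
     after the shift by [s *: w]; that set is null because [s] is positive. *)
  move=> jk; pose s : R := j.+1%:R^-1 - k.+1%:R^-1.
  have s0 : 0 < s by rewrite subr_gt0 ltf_pV2 ?posrE // ltr_nat ltnS.
  rewrite -[RHS](ret0 s s0) -[RHS](lebR2n_shift _ (- (j.+1%:R^-1 *: w))); last first.
    exact: (measurableI _ _ mE (mS _ _ mE)).
  have jkE x : x - j.+1%:R^-1 *: w + s *: w = x - k.+1%:R^-1 *: w.
    by rewrite /s scalerBl addrA subrK.
  congr (lebR2n R n _); apply/seteqP; split => x [/= Ej Ek]; split => //=.
    by rewrite jkE.
  by rewrite /F /= -jkE.
(* Each translation vector has norm at most [|w|]; the extra 1 makes the bound strict. *)
have e'0 : 0 < e + (`|w| + 1) by rewrite addr_gt0 // ltr_wpDl.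
have FB k : F k `<=` ball p (e + (`|w| + 1)).
  move=> x /= /Ee; rewrite -ball_normE /= => px.
  rewrite (_ : p - x = (p - (x - k.+1%:R^-1 *: w)) - k.+1%:R^-1 *: w); last first.
    by rewrite opprB addrA addrAC addrK.
  apply: le_lt_trans (ler_normB _ _) _; apply: ltrD => //.
  rewrite normrZ ger0_norm ?invr_ge0 //.
  apply: le_lt_trans (_ : `|w| < _); last by rewrite ltrDl.
  by rewrite ler_piMl // invf_le1 // ler1n.
have Boo := lebR2n_ball_lty p e'0.
have Eoo : (lebR2n R n E < +oo)%E.
  apply: le_lt_trans Boo; rewrite -(FE 0%N).
  by apply: le_measure; rewrite ?inE //; exact: measurable_ball_pair.
have bound k : (\sum_(i < k) lebR2n R n E <= lebR2n R n (ball p (e + (`|w| + 1))))%E.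
  rewrite (_ : (\sum_(i < k) _)%E = lebR2n R n (\big[setU/set0]_(i < k) F i)); last first.
    by rewrite measure_bigsetU_null //; apply: eq_bigr => i _; exact/esym/FE.
  apply: le_measure; rewrite ?inE; first by exact: bigsetU_measurable.
  - exact: measurable_ball_pair.
  - by apply: (big_ind (fun A => A `<=` ball p (e + (`|w| + 1)))) => // A B Ab Bb x [/Ab|/Bb].
have Efin : lebR2n R n E \is a fin_num by rewrite ge0_fin_numE.
have Bfin : lebR2n R n (ball p (e + (`|w| + 1))) \is a fin_num by rewrite ge0_fin_numE.
move: E0 bound; rewrite -(fineK Efin) -(fineK Bfin).
move: (fine _) (fine _) => V m; rewrite lte_fin => m0 bound.
(* [m] is the measure of [E] and [V] that of the large ball: more than [V / m] almost disjoint
   copies do not fit. *)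
have := bound (Num.truncn (V / m)).+1.
rewrite sumEFin lee_fin sumr_const card_ord -mulr_natl leNgt => /negP; apply.
by rewrite -ltr_pdivrMr // truncnS_gt.
Qed.

(** * Mean value theorems along lines and for mixed second differences *)

(** The difference quotients coincide, which makes one-variable calculus applicable to directional
    derivatives. *)
Lemma is_derive_line {R : realType} {V : normedModType R} {f : V -> R} {x v : V} {s : R} :
  derivable f (x + s *: v) v ->
  is_derive s 1 (fun r : R => f (x + r *: v)) ('D_v f (x + s *: v)).
Proof.
have quotE : (fun h : R => h^-1 *: (((fun r : R => f (x + r *: v)) \o shift s) (h *: 1) - f (x + s *: v))) =
    (fun h : R => h^-1 *: ((f \o shift (x + s *: v)) (h *: v) - f (x + s *: v))).
  apply/funext => h; congr (_ *: (f _ - _)); rewrite /= scalerDl addrCA.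
  by rewrite [h *: 1]mulr1.
by move=> df; split; [rewrite /derivable quotE|rewrite /derive quotE].
Qed.

Lemma MVT_line {R : realType} {V : normedModType R} {f : V -> R} {x v : V} {t : R} :
  0 < t -> (forall s, 0 <= s <= t -> derivable f (x + s *: v) v) ->
  exists2 s, 0 <= s <= t & f (x + t *: v) - f x = 'D_v f (x + s *: v) * t.
Proof.
move=> t0 df; pose g (r : R) := f (x + r *: v).
have dg s : 0 <= s <= t -> is_derive s 1 g ('D_v f (x + s *: v)).
  by move=> st; exact/is_derive_line/df.
have [s||s] := @MVT R g (fun s => 'D_v f (x + s *: v)) 0 t t0.
- by rewrite in_itv /= => /andP[/ltW s0 /ltW st]; apply: dg; rewrite s0 st.
- apply: derivable_within_continuous => s; rewrite in_itv /= => st.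
  by have [] := dg s st.
rewrite in_itv /= => /andP[/ltW s0 /ltW st]; rewrite /g scale0r addr0 subr0 => E.
by exists s; rewrite ?s0.
Qed.

(** The mean value theorem is used twice: in direction [v] on the increment [g], then in direction
    [u] on ['D_v f]. *)
Lemma mixed_difference {R : realType} {V : normedModType R} {f : V -> R} {x u v : V} {t r : R} :
  0 < t -> 0 < r ->
  (forall s s', 0 <= s <= t -> 0 <= s' <= r ->
     derivable f (x + s *: u + s' *: v) v /\ derivable ('D_v f) (x + s *: u + s' *: v) u) ->
  exists s s', [/\ 0 <= s <= t, 0 <= s' <= r &
    f x - f (x + t *: u) - f (x + r *: v) + f (x + t *: u + r *: v) =
      'D_u ('D_v f) (x + s *: u + s' *: v) * t * r].
Proof.
move=> t0 r0 df.
have tt : 0 <= t <= t by rewrite lexx ltW.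
have t00 : 0 <= (0 : R) <= t by rewrite lexx ltW.
pose g (y : R) := f (x + t *: u + y *: v) - f (x + y *: v).
have dg s' : 0 <= s' <= r -> is_derive s' 1 g
    ('D_v f (x + t *: u + s' *: v) - 'D_v f (x + s' *: v)).
  move=> sr; apply: is_deriveB.
    by apply: is_derive_line; have [] := df t s' tt sr.
  by apply: is_derive_line; have [] := df 0 s' t00 sr; rewrite scale0r addr0.
have [s'||s'] := @MVT R g (fun s' => 'D_v f (x + t *: u + s' *: v) - 'D_v f (x + s' *: v)) 0 r r0.
- by rewrite in_itv /= => /andP[/ltW s0 /ltW st]; apply: dg; rewrite s0 st.
- apply: derivable_within_continuous => s; rewrite in_itv /= => st.
  by have [] := dg s st.
rewrite in_itv /= => /andP[/ltW s'0 /ltW s'r]; rewrite /g !scale0r !addr0 subr0 => E1.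
have [|s st E2] := @MVT_line R V ('D_v f) (x + s' *: v) u t t0.
  by move=> s st; rewrite addrAC; have [] := df s s' st; rewrite ?s'0.
exists s, s'; split; rewrite ?s'0 //.
rewrite [x + s *: u + _]addrAC -E2 [x + s' *: v + _]addrAC -E1.
by rewrite opprB addrA [RHS]addrC; lra.
Qed.

(** Convexity of balls: the point is the convex combination of the two ends with weight [s / t] on
    the far one. *)
Lemma ball_segment {R : realType} {V : normedModType R} {q x v : V} {e t s : R} :
  0 < t -> 0 <= s <= t -> ball q e x -> ball q e (x + t *: v) -> ball q e (x + s *: v).
Proof.
move=> t0 /andP[s0 st]; rewrite -ball_normE /= => qx qxt.
have l0 : 0 <= s / t by rewrite divr_ge0 // ltW.
have l1 : s / t <= 1 by rewrite ler_pdivrMr // mul1r.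
have -> : q - (x + s *: v) = (1 - s / t) *: (q - x) + (s / t) *: (q - (x + t *: v)).
  rewrite !opprD !addrA [_ *: (q - x - _)]scalerBr scalerA divfK ?gt_eqF //.
  by rewrite scalerBl scale1r addrA subrK.
apply: le_lt_trans (ler_normD _ _) _; rewrite !normrZ !ger0_norm ?subr_ge0 //.
(* The strict inequality is taken from the far end, so its weight must be nonzero. *)
have [->|l_neq0] := eqVneq (s / t) 0; first by rewrite subr0 mul1r mul0r addr0.
have lp : 0 < s / t by rewrite lt_def l_neq0.
rewrite [ltRHS](_ : e = (1 - s / t) * e + (s / t) * e); last by rewrite -mulrDl subrK mul1r.
by apply: ler_ltD; [rewrite ler_wpM2l ?subr_ge0 // ltW|rewrite ltr_pM2l].
by rewrite invr_ge0 ltW.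
Qed.

(** * Balls on which one mixed derivative of the cost keeps its sign *)

Section good_balls.
Context {R : realType} {d : nat}.
Local Notation P := (Rvec R d * Rvec R d)%type.

Lemma scale_dir_x (t : R) (i : 'I_d) : t *: dir_x R i = (t *: delta_mx 0 i, 0).
Proof. by rewrite /dir_x; congr (_, _); rewrite /= scaler0. Qed.

Lemma scale_dir_y (t : R) (j : 'I_d) : t *: dir_y R j = (0, t *: delta_mx 0 j).
Proof. by rewrite /dir_y; congr (_, _); rewrite /= scaler0. Qed.

(* Three corners suffice because a ball of a product is a product of balls. *)
Lemma ball_rectangle {q x : P} {e t r s s' : R} {i j : 'I_d} :
  0 < t -> 0 < r -> 0 <= s <= t -> 0 <= s' <= r ->
  ball q e x -> ball q e (x + t *: dir_x R i) -> ball q e (x + r *: dir_y R j) ->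
  ball q e (x + s *: dir_x R i + s' *: dir_y R j).
Proof.
move=> t0 r0 st sr [q1 q2] [qt _] [_ qr].
move: qt qr; rewrite !scale_dir_x !scale_dir_y => qt qr; split => /=.
  by rewrite addr0; exact: (ball_segment t0 st).
by rewrite addr0; exact: (ball_segment r0 sr).
Qed.

(** The mean value point lies in the rectangle spanned by the corners, hence in the ball; the factor
    [k] only records the sign there. *)
Lemma mixed_difference_ball {c : P -> R} {q x : P} {e t r k : R} {i j : 'I_d} :
  (forall p, ball q e p -> [/\ derivable c p (dir_y R j),
     derivable ('D_(dir_y R j) c) p (dir_x R i) &
     0 < k * 'D_(dir_x R i) ('D_(dir_y R j) c) p]) ->
  0 < t -> 0 < r ->
  ball q e x -> ball q e (x + t *: dir_x R i) -> ball q e (x + r *: dir_y R j) ->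
  0 < k * (c x - c (x + t *: dir_x R i) - c (x + r *: dir_y R j)
           + c (x + t *: dir_x R i + r *: dir_y R j)).
Proof.
move=> good t0 r0 qx qt qr.
have [|s [s' [st sr ->]]] := @mixed_difference R P c x (dir_x R i) (dir_y R j) t r t0 r0.
  by move=> s s' st sr; have [] := good _ (ball_rectangle t0 r0 st sr qx qt qr).
have [_ _ pos] := good _ (ball_rectangle t0 r0 st sr qx qt qr).
by rewrite !mulrA; do 2?apply: mulr_gt0.
Qed.

(** Some entry of the mixed Hessian is nonzero at [p]. Its value there serves as [k]; by continuity
    the sign persists nearby, and since [Z] is closed the ball can be chosen to avoid it. *)
Lemma good_ratball {c : P -> R} {Z : set P} {p : P} :
  (0 < d)%N -> closed Z -> C2_on (~` Z) c ->
  \det (mixed_hessian c p) != 0 -> ~ Z p ->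
  exists m i j (k : R), [/\ k != 0, ratball d m p &
    forall q, ratball d m q -> [/\ derivable c q (dir_y R j),
     derivable ('D_(dir_y R j) c) q (dir_x R i) &
     0 < k * 'D_(dir_x R i) ('D_(dir_y R j) c) q]].
Proof.
move=> d0 cZ C2 detn0 Zp.
(* Here [0 < d] matters: the empty matrix has determinant 1. *)
have [i [j ij0]] : exists i j, mixed_hessian c p i j != 0.
  apply: contrapT => no; move: detn0; rewrite (_ : mixed_hessian c p = 0).
    by case: d d0 => // n _; rewrite det0 eqxx.
  apply/matrixP => i j; rewrite [RHS]mxE; apply/eqP; apply: contrapT => /negP ij.
  by apply: no; exists i, j.
rewrite mxE in ij0.
set D := 'D_(dir_x R i) ('D_(dir_y R j) c) in ij0 *.
have xi : coord_dirs (dir_x R i) by exists i; left.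
have yj : coord_dirs (dir_y R j) by exists j; right.
have cD : {for p, continuous D} by have [_ _ /(_ _ _ yj xi)[]] := C2 p Zp.
have nD : nbhs p [set q | 0 < D p * D q].
  apply: (cD [set y | 0 < D p * y]).
  apply: (@mulrl_continuous R (D p) (D p) [set y | 0 < y]).
  by apply: lt_nbhsr; rewrite -expr2 exprn_even_gt0.
have nZ : nbhs p (~` Z) by apply: open_nbhs_nbhs; split => //; exact: closed_openC.
have [m [mp mU]] := nbhs_ratball (filterI nD nZ).
exists m, i, j, (D p); split; [exact: ij0|exact: mp|move=> q /mU[Dq Zq]].
have [_ /(_ _ yj)[dq _] /(_ _ _ yj xi)[ddq _]] := C2 q Zq.
by split; [exact: dq|exact: ddq|exact: Dq].
Qed.

End good_balls.

(** * Integrability criteria, alternating sums, and positivity of integrals *)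

Section integrals.
Local Open Scope ereal_scope.
Context {d : measure_display} {T : measurableType d} {R : realType}.
Variable mu : {measure set T -> \bar R}.

Lemma integrable_indic_lty (A : set T) : measurable A -> mu A < +oo ->
  mu.-integrable setT (fun x => (\1_A x)%:E).
Proof.
move=> mA Aoo; apply/integrableP; split; first exact/measurable_EFinP.
under eq_integral do rewrite gee0_abs ?lee_fin //.
by rewrite integral_indic // setIT.
Qed.

(* In MathComp-Analysis [+oo - +oo = -oo], so a finite integral forces both the
   positive and the negative part to have finite integral. *)
Lemma integrable_of_fin_num (F : T -> \bar R) : measurable_fun setT F ->
  \int[mu]_x F x \is a fin_num -> mu.-integrable setT F.
Proof.
move=> mF; rewrite integralE fin_numB => /andP[pfin nfin].
apply/integrableP; split => //.
rewrite -[X in X < _]/(\int[mu]_x (abse \o F) x) fune_abse.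
rewrite ge0_integralD //; last 2 first.
- exact: measurable_funepos.
- exact: measurable_funeneg.
by rewrite lte_add_pinfty // -ge0_fin_numE // integral_ge0.
Qed.

Lemma integrable_alternating {A B C D : T -> R} :
  mu.-integrable setT (EFin \o A) -> mu.-integrable setT (EFin \o B) ->
  mu.-integrable setT (EFin \o C) -> mu.-integrable setT (EFin \o D) ->
  mu.-integrable setT (fun x => (A x - B x - C x + D x)%:E).
Proof.
move=> iA iB iC iD.
exact: (integrableD measurableT (integrableB measurableT (integrableB measurableT iA iB) iC) iD).
Qed.

Lemma integral_alternating {A B C D : T -> R} :
  mu.-integrable setT (EFin \o A) -> mu.-integrable setT (EFin \o B) ->
  mu.-integrable setT (EFin \o C) -> mu.-integrable setT (EFin \o D) ->
  \int[mu]_x (A x - B x - C x + D x)%:E =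
  \int[mu]_x (A x)%:E - \int[mu]_x (B x)%:E - \int[mu]_x (C x)%:E + \int[mu]_x (D x)%:E.
Proof.
move=> iA iB iC iD.
have iAB := integrableB measurableT iA iB.
rewrite (integralD measurableT (integrableB measurableT iAB iC) iD).
by rewrite (integralB measurableT iAB iC) (integralB measurableT iA iB).
Qed.

(** A nonnegative function with zero integral vanishes almost everywhere, which would make [G]
    null. *)
Lemma integral_gt0_of_pos {F : T -> R} {G : set T} :
  measurable_fun setT F -> (forall x, (0 <= F x)%R) ->
  measurable G -> 0 < mu G -> (forall x, G x -> (0 < F x)%R) ->
  0 < \int[mu]_x (F x)%:E.
Proof.
move=> mF F0 mG G0 FG; rewrite lt_neqAle integral_ge0 ?andbT; last first.
  by move=> x _; rewrite lee_fin.
apply/eqP => /esym int0; suff : mu G = 0 by move=> G00; rewrite G00 ltxx in G0.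
apply/negligibleP => //.
have mF' : measurable_fun setT (EFin \o F) by exact/measurable_EFinP.
have [aeF _] := ae_eq_integral_abs mu measurableT mF'.
have : ae_eq mu setT (EFin \o F) (cst 0).
  apply: aeF; rewrite -[RHS]int0; apply: eq_integral => x _.
  by rewrite /= ger0_norm.
apply: negligibleS => x Gx /= /(_ I) [Fx0].
by have := FG x Gx; rewrite Fx0 ltxx.
Qed.

End integrals.

(** * The four-corner perturbation: its marginals and its cost *)

Section perturbation.
Context {R : realType} {d : nat}.
Local Notation P := (Rvec R d * Rvec R d)%type.
Context {G : set P} {q : P} {e : R}.
Hypotheses (mG : measurable G) (e0 : 0 < e) (Ge : G `<=` ball q e).

(** Since [\1_G (p - w)] is the indicator of [G + w], this is the density of the signed mass that
    the exchange adds. The four translates may overlap. *)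
Definition rectangle (u v p : P) : R :=
  \1_G p - \1_G (p - u) - \1_G (p - v) + \1_G (p - (u + v)).

Lemma integrable_translated_indic (w : P) :
  (lebR2n R d).-integrable setT (EFin \o (fun p => \1_G (p - w))).
Proof.
have iG : (lebR2n R d).-integrable setT (EFin \o \1_G).
  apply: integrable_indic_lty => //; apply: le_lt_trans (lebR2n_ball_lty q e0).
  by apply: le_measure; rewrite ?inE //; exact: measurable_ball_pair.
exact: (integrable_measure_preserving (measurable_shift_pair _ (- w)) (lebR2n_shift _ (- w)) _ iG).
Qed.

Lemma integrable_rectangle u v :
  (lebR2n R d).-integrable setT (EFin \o rectangle u v).
Proof.
have iG : (lebR2n R d).-integrable setT (EFin \o \1_G).
  have := integrable_translated_indic 0; congr (_.-integrable _ _).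
  by apply/funext => p /=; rewrite subr0.
by apply: integrable_alternating => //; exact: integrable_translated_indic.
Qed.

Lemma rectangle_supp {u v p} {E : set P} : (forall p, G p -> E p) ->
  (forall p, G p -> E (p + u)) -> (forall p, G p -> E (p + v)) ->
  (forall p, G p -> E (p + (u + v))) -> ~ E p -> rectangle u v p = 0.
Proof.
move=> E1 E2 E3 E4 Ep; rewrite /rectangle !indicE !memNset ?subr0 ?addr0 //.
- by move=> /E4; rewrite subrK.
- by move=> /E3; rewrite subrK.
- by move=> /E2; rewrite subrK.
- by move=> /E1.
Qed.

Lemma rectangle_le u v p : `|rectangle u v p| <= 4.
Proof.
rewrite /rectangle !indicE.
by do 4 (case: (_ \in _)); rewrite /= ler_norml; apply/andP; split; lra.
Qed.

(** Sections of a ball lie in balls of finite measure, so this holds at every [x] and not just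
    almost every one. *)
Lemma integrable_indic_section_y x :
  (lebRn R d).-integrable setT (fun y => (\1_G (x, y))%:E).
Proof.
have mGx : measurable ((pair x : Rvec R d -> P) @^-1` G).
  by rewrite -[X in measurable X]setTI; exact: measurable_pair1.
apply: (integrable_indic_lty _ ((pair x : Rvec R d -> P) @^-1` G)) => //.
apply: le_lt_trans (lebRn_ball_lty q.2 e0); apply: le_measure; rewrite ?inE //.
  exact: measurable_ball_Rvec.
by move=> y /= /Ge[].
Qed.

Lemma integrable_indic_section_x y :
  (lebRn R d).-integrable setT (fun x => (\1_G (x, y))%:E).
Proof.
have mGy : measurable ((fun x => (x, y) : P) @^-1` G).
  by rewrite -[X in measurable X]setTI; exact: measurable_pair2.
apply: (integrable_indic_lty _ ((fun x => (x, y) : P) @^-1` G)) => //.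
apply: le_lt_trans (lebRn_ball_lty q.1 e0); apply: le_measure; rewrite ?inE //.
  exact: measurable_ball_Rvec.
by move=> x /= /Ge[].
Qed.

(** By translation invariance each function cancels against its own translate. *)
Lemma integral_alternating_shift (k1 k2 : Rvec R d -> R) (w : Rvec R d) :
  (lebRn R d).-integrable setT (EFin \o k1) ->
  (lebRn R d).-integrable setT (EFin \o k2) ->
  (lebRn R d).-integrable setT (fun z => (k1 z - k2 z - k1 (z - w) + k2 (z - w))%:E) /\
  (\int[lebRn R d]_z (k1 z - k2 z - k1 (z - w) + k2 (z - w))%:E = 0)%E.
Proof.
move=> ik1 ik2.
have shiftE (k : Rvec R d -> R) : (lebRn R d).-integrable setT (EFin \o k) ->
   (lebRn R d).-integrable setT (EFin \o (fun z => k (z - w))) /\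
   (\int[lebRn R d]_z (k (z - w))%:E = \int[lebRn R d]_z (k z)%:E)%E.
  move=> ik; have ms := measurable_shift _ (- w); have inv := lebRn_shift d (- w).
  split; first exact: (integrable_measure_preserving ms inv _ ik).
  exact: (integral_measure_preserving ms inv _ ik).
have [i1 E1] := shiftE _ ik1; have [i2 E2] := shiftE _ ik2.
split; first exact: integrable_alternating.
rewrite integral_alternating // E1 E2.
have := integrable_fin_num measurableT ik1; have := integrable_fin_num measurableT ik2.
(* Both integrals are finite, so the cancellation takes place in the reals. *)
rewrite /=; move: (integral _ _ _) (integral _ _ _) => a b.
by case: a => [a| |] //; case: b => [b| |] // _ _; congr (_%:E); lra.
Qed.

Let sub_pair_x (x y w : Rvec R d) : ((x, y) : P) - (w, 0) = (x - w, y).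
Proof. by congr (_, _); rewrite /= subr0. Qed.

Let sub_pair_y (x y w : Rvec R d) : ((x, y) : P) - (0, w) = (x, y - w).
Proof. by congr (_, _); rewrite /= subr0. Qed.

Let sub_pair_xy (x y w1 w2 : Rvec R d) :
  ((x, y) : P) - ((w1, 0) + (0, w2)) = (x - w1, y - w2).
Proof. by congr (_, _); rewrite /= ?addr0 ?add0r. Qed.

(** For fixed [x] the four terms are the sections of [G] at [x] and at [x - w1], each paired with
    its translate by [w2] of opposite sign. *)
Lemma rectangle_marginal_y (w1 w2 : Rvec R d) x :
  (lebRn R d).-integrable setT (fun y => (rectangle (w1, 0) (0, w2) (x, y))%:E) /\
  (\int[lebRn R d]_y (rectangle (w1, 0) (0, w2) (x, y))%:E = 0)%E.
Proof.
have -> : (fun y => (rectangle (w1, 0) (0, w2) (x, y))%:E) =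
    (fun y => (\1_G (x, y) - \1_G (x - w1, y) - \1_G (x, y - w2) + \1_G (x - w1, y - w2))%:E).
  apply/funext => y; congr (_%:E); rewrite /rectangle.
  by rewrite sub_pair_x sub_pair_y sub_pair_xy.
exact: (integral_alternating_shift _ _ _ (integrable_indic_section_y x)
          (integrable_indic_section_y (x - w1))).
Qed.

Lemma rectangle_marginal_x (w1 w2 : Rvec R d) y :
  (lebRn R d).-integrable setT (fun x => (rectangle (w1, 0) (0, w2) (x, y))%:E) /\
  (\int[lebRn R d]_x (rectangle (w1, 0) (0, w2) (x, y))%:E = 0)%E.
Proof.
have -> : (fun x => (rectangle (w1, 0) (0, w2) (x, y))%:E) =
    (fun x => (\1_G (x, y) - \1_G (x, y - w2) - \1_G (x - w1, y) + \1_G (x - w1, y - w2))%:E).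
  apply/funext => x; congr (_%:E); rewrite /rectangle.
  rewrite sub_pair_x sub_pair_y sub_pair_xy; congr (_ + _); exact: addrAC.
exact: (integral_alternating_shift _ _ _ (integrable_indic_section_x y)
          (integrable_indic_section_x (y - w2))).
Qed.

Context {c : P -> R} {M : R}.
Hypotheses (mc : measurable_fun setT c) (cM : forall p, `|c p| <= M).

Lemma integrable_cost_mul {h : P -> R} : (lebR2n R d).-integrable setT (EFin \o h) ->
  (lebR2n R d).-integrable setT (fun p => (c p * h p)%:E).
Proof.
apply: integrableMr => //.
exists M; split; first exact: num_real.
by move=> N MN p _; exact: le_trans (cM p) (ltW MN).
Qed.

(** A change of variables moves the translation from the indicator to the cost. *)
Lemma integral_cost_translated_indic (w : P) :
  (lebR2n R d).-integrable setT (fun p => (c (p + w) * \1_G p)%:E) /\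
  (\int[lebR2n R d]_p (c p * \1_G (p - w))%:E = \int[lebR2n R d]_p (c (p + w) * \1_G p)%:E)%E.
Proof.
have shiftE (F : P -> R) : (fun p => (F (p + w))%:E) = (fun p => (F p)%:E) \o shift w by [].
have iw := integrable_cost_mul (integrable_translated_indic w).
have E : (fun p => (c (p + w) * \1_G p)%:E) = (fun p => (c p * \1_G (p - w))%:E) \o shift w.
  by apply/funext => p /=; rewrite addrK.
have ms := measurable_shift_pair _ w; have inv := lebR2n_shift d w.
split; first by rewrite E; exact: (integrable_measure_preserving ms inv _ iw).
rewrite -(integral_measure_preserving ms inv _ iw).
by apply: eq_integral => p _ /=; rewrite addrK.
Qed.

Lemma integral_cost_rectangle u v :
  (\int[lebR2n R d]_p (c p * rectangle u v p)%:E =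
   \int[lebR2n R d]_p ((c p - c (p + u) - c (p + v) + c (p + (u + v))) * \1_G p)%:E)%E.
Proof.
have i w := integrable_cost_mul (integrable_translated_indic w).
have [j0 E0] := integral_cost_translated_indic 0.
have [ju Eu] := integral_cost_translated_indic u.
have [jv Ev] := integral_cost_translated_indic v.
have [juv Euv] := integral_cost_translated_indic (u + v).
(* Writing [p - 0] gives all four terms one form, with [w] equal to 0, [u], [v] and [u + v]. *)
have -> : (fun p => (c p * rectangle u v p)%:E) =
    (fun p => (c p * \1_G (p - 0) - c p * \1_G (p - u) - c p * \1_G (p - v)
               + c p * \1_G (p - (u + v)))%:E).
  by apply/funext => p; congr (_%:E); rewrite subr0 /rectangle; ring.
have -> : (fun p => ((c p - c (p + u) - c (p + v) + c (p + (u + v))) * \1_G p)%:E) =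
    (fun p => (c (p + 0) * \1_G p - c (p + u) * \1_G p - c (p + v) * \1_G p
               + c (p + (u + v)) * \1_G p)%:E).
  by apply/funext => p; congr (_%:E); rewrite addr0; ring.
rewrite (integral_alternating _ (i 0) (i u) (i v) (i (u + v))).
by rewrite (integral_alternating _ j0 ju jv juv) E0 Eu Ev Euv.
Qed.

End perturbation.

Arguments rectangle {R d} G u v p.

(** * Finding a sign-definite ball and a rectangle in a set of positive measure *)

Lemma measurable_superlevel {disp : measure_display} {T : measurableType disp}
    {R : realType} {F : T -> R} (a : R) :
  measurable_fun setT F -> measurable [set x | a <= F x].
Proof.
move=> mF; rewrite (_ : [set x | _] = setT `&` F @^-1` `[a, +oo[%classic).
  by apply: mF.
by rewrite setTI; apply/seteqP; split => x; rewrite /= in_itv /= andbT.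
Qed.

(** Off the null set [Z] every point lies in a good rational ball. If all of these met [E] in null
    sets, countability would make [E] null. *)
Lemma good_ball_positive {R : realType} {d : nat} {c : Rvec R d * Rvec R d -> R}
    {Z E : set (Rvec R d * Rvec R d)} :
  (0 < d)%N -> closed Z -> (lebR2n R d).-negligible Z -> C2_on (~` Z) c ->
  (forall p, ~ Z p -> \det (mixed_hessian c p) != 0) ->
  measurable E -> (0 < lebR2n R d E)%E ->
  exists m i j (k : R), [/\ k != 0, (0 < lebR2n R d (E `&` ratball d m))%E &
    forall q, ratball d m q -> [/\ derivable c q (dir_y R j),
     derivable ('D_(dir_y R j) c) q (dir_x R i) &
     0 < k * 'D_(dir_x R i) ('D_(dir_y R j) c) q]].
Proof.
move=> d0 cZ nZ C2 nondeg mE E0; apply: contrapT => no.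
suff nE : (lebR2n R d).-negligible E.
  by move/negligibleP : nE => /(_ mE) E00; rewrite E00 ltxx in E0.
(* Only the null intersections are kept, so the union of all [F m] is null. *)
pose F m := if lebR2n R d (E `&` ratball d m) == 0%E then E `&` ratball d m else set0.
have nF m : (lebR2n R d).-negligible (F m).
  rewrite /F; case: eqP => [Em0|_]; last exact: negligible_set0.
  by apply/negligibleP => //; apply: measurableI => //; exact: measurable_ratball.
apply: negligibleS (negligibleU nZ (negligible_bigcup nF)) => p Ep.
have [Zp|Zp] := pselect (Z p); [by left|right].
have [m [i [j [k [k0 mp good]]]]] := good_ratball d0 cZ C2 (nondeg _ Zp) Zp.
exists m => //; rewrite /F; case: eqP => // /eqP Em; exfalso; apply: no.
by exists m, i, j, k; split; [exact: k0|rewrite lt_def Em measure_ge0|exact: good].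
Qed.

Lemma rectangle_in_set {R : realType} {d : nat} {E : set (Rvec R d * Rvec R d)}
    {m : nat} (i j : 'I_d) :
  measurable E -> E `<=` ratball d m -> (0 < lebR2n R d E)%E ->
  exists t r (G : set (Rvec R d * Rvec R d)),
   [/\ 0 < t, 0 < r, measurable G, (0 < lebR2n R d G)%E &
    forall p, G p -> [/\ E p, E (p + t *: dir_x R i), E (p + r *: dir_y R j) &
      E (p + (t *: dir_x R i + r *: dir_y R j))]].
Proof.
move=> mE Em E0; have [q [e [e0 mqe]]] := @ratballE R d m.
have Ee : E `<=` ball q e by rewrite -mqe.
have mS (v : Rvec R d * Rvec R d) (A : set (Rvec R d * Rvec R d)) :
    measurable A -> measurable (shift v @^-1` A).
  by move=> mA; rewrite -[X in measurable X]setTI; exact: measurable_shift_pair.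
have [t t0 Et0] := recurrence (dir_x R i) q e E e0 mE Ee E0.
set E1 := _ `&` _ in Et0.
have mE1 : measurable E1 := measurableI _ _ mE (mS _ _ mE).
have E1e : E1 `<=` ball q e by move=> p [/Ee].
(* Recurrence is applied to [E1] rather than [E]: if [p] and its [y]-translate both lie in [E1],
   then all four corners lie in [E]. *)
have [r r0 Er0] := recurrence (dir_y R j) q e E1 e0 mE1 E1e Et0.
exists t, r, (E1 `&` shift (r *: dir_y R j) @^-1` E1); split => //.
  exact: (measurableI _ _ mE1 (mS _ _ mE1)).
move=> p [[Ep Etp] [/= Erp Etrp]]; split => //.
by rewrite addrA addrAC.
Qed.

(** * Admissible perturbations and the strict decrease of the cost *)

Section minimizer.
Context {R : realType} {d : nat}.
Local Notation P := (Rvec R d * Rvec R d)%type.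
Context {c hbar h : P -> R} {f g : Rvec R d -> R}.
Hypotheses (hbarL : Linfty_c_R2d hbar) (hG : Gamma_bar f g hbar h).

Lemma Gamma_bar_perturbation {E : set P} {k : P -> R} {delta : R} :
  (forall p, E p -> delta <= h p /\ delta <= hbar p - h p) ->
  (forall p, ~ E p -> k p = 0) -> (forall p, `|k p| <= delta) -> 0 < delta ->
  (lebR2n R d).-integrable setT (EFin \o k) ->
  (forall x, (lebRn R d).-integrable setT (fun y => (k (x, y))%:E) /\
     (\int[lebRn R d]_y (k (x, y))%:E = 0)%E) ->
  (forall y, (lebRn R d).-integrable setT (fun x => (k (x, y))%:E) /\
     (\int[lebRn R d]_x (k (x, y))%:E = 0)%E) ->
  Gamma_bar f g hbar (fun p => h p + k p).
Proof.
move=> Eh kE kd delta0 ik margy margx.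
have [[h0 [ih _] hf hg] hhbar] := hG.
have mh : measurable_fun setT h by have /integrableP[/measurable_EFinP] := ih.
have bounds p : 0 <= h p -> h p <= hbar p -> 0 <= h p + k p <= hbar p.
  have [/Eh[dh dhb]|/kE ->] := pselect (E p); last by rewrite addr0 => -> ->.
  by move=> _ _; have := kd p; rewrite ler_norml => /andP[k1 k2]; apply/andP; split; lra.
split; first split.
- by apply: filterS2 h0 hhbar => p h0 hb; have /andP[] := bounds p h0 hb.
- split.
    exact: (integrableD measurableT ih ik).
  (* The compact set is that of [hbar]: where [hbar] vanishes, the bounds force the perturbed
     density to vanish. *)
  have [_ [_ [K [cK hK]]]] := hbarL; exists K; split => //.
  apply: filterS3 hK h0 hhbar => p hK h0 hb Kp.
  by have /andP[] := bounds p h0 hb; rewrite (hK Kp) => ? ?; lra.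
- apply: filterS hf => x hfx; have [ikx kx0] := margy x.
  have mhx : measurable_fun setT (fun y => (h (x, y))%:E).
    by apply/measurable_EFinP; exact: (measurableT_comp mh (measurable_pair1 x)).
  have ihx : (lebRn R d).-integrable setT (fun y => (h (x, y))%:E).
    (* The marginal identity gives the section of [h] a finite integral, hence integrability, so the
       integral of the sum splits. *)
    by apply: integrable_of_fin_num => //; rewrite hfx.
  by under eq_integral do rewrite EFinD; rewrite (integralD measurableT ihx ikx) kx0 adde0.
- apply: filterS hg => y hgy; have [iky ky0] := margx y.
  have mhy : measurable_fun setT (fun x => (h (x, y))%:E).
    by apply/measurable_EFinP; exact: (measurableT_comp mh (measurable_pair2 y)).
  have ihy : (lebRn R d).-integrable setT (fun x => (h (x, y))%:E).
    by apply: integrable_of_fin_num => //; rewrite hgy.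
  by under eq_integral do rewrite EFinD; rewrite (integralD measurableT ihy iky) ky0 adde0.
- by apply: filterS2 h0 hhbar => p h0 hb; have /andP[] := bounds p h0 hb.
Qed.

(** A margin of [delta] below and above admits perturbations of either sign up to that size, one of
    which would lower the cost. *)
Lemma minimizer_slack_null {Z : set P} {M delta : R} :
  (0 < d)%N -> continuous c -> (forall p, `|c p| <= M) ->
  closed Z -> (lebR2n R d).-negligible Z -> C2_on (~` Z) c ->
  (forall p, ~ Z p -> \det (mixed_hessian c p) != 0) ->
  (forall h', Gamma_bar f g hbar h' -> (Ic c h <= Ic c h')%E) ->
  0 < delta ->
  lebR2n R d ([set p | delta <= h p] `&` [set p | delta <= hbar p - h p]) = 0%E.
Proof.
move=> d0 cc cM cZ nZ C2 nondeg hmin delta0.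
have mc := continuous_measurable_pair cc.
have [[_ [ih _] _ _] _] := hG; have [mhbar _] := hbarL.
have mh : measurable_fun setT h by have /integrableP[/measurable_EFinP] := ih.
set E0 := _ `&` _.
have mE0 : measurable E0.
  by apply: measurableI; apply: measurable_superlevel => //; exact: measurable_funB.
apply/eqP; rewrite -measure_le0 leNgt; apply/negP => E00.
have [m [i [j [k [k0 posE good]]]]] := good_ball_positive d0 cZ nZ C2 nondeg mE0 E00.
set E := _ `&` _ in posE.
have mE : measurable E := measurableI _ _ mE0 (measurable_ratball _ _).
have Em : E `<=` ratball d m by move=> p [].
have [t [r [G [t0 r0 mG posG GE]]]] := rectangle_in_set i j mE Em posE.
have [q [e [e0 mqe]]] := @ratballE R d m.
have Ge : G `<=` ball q e by move=> p /GE[/Em]; rewrite mqe.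
set u := t *: dir_x R i in GE; set v := r *: dir_y R j in GE.
(* The sign opposes [k], so the cost decreases; the size [delta / 4] offsets the bound 4 on
   [rectangle]. *)
pose s := - k * (delta / 4 / `|k|).
have normk : 0 < `|k| by rewrite normr_gt0.
have ns : `|s| = delta / 4.
  by rewrite normrM normrN [`|_ / _|]ger0_norm ?divr_ge0 ?ltW ?divr_gt0 // mulrC divfK ?gt_eqF.
have irect := integrable_rectangle mG e0 Ge u v.
have uE : u = (t *: delta_mx 0 i, 0) by exact: scale_dir_x.
have vE : v = (0, r *: delta_mx 0 j) by exact: scale_dir_y.
have adm : Gamma_bar f g hbar (fun p => h p + s * rectangle G u v p).
  apply: (@Gamma_bar_perturbation E _ delta) => //.
  - by move=> p [[]].
  - move=> p Ep; rewrite (@rectangle_supp _ _ _ u v p E) ?mulr0 //.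
    + by move=> y /GE[].
    + by move=> y /GE[].
    + by move=> y /GE[].
    + by move=> y /GE[].
  - move=> p; rewrite normrM ns; have := rectangle_le (G := G) u v p; nra.
  - exact: (integrableZl measurableT s irect).
  - move=> x; rewrite uE vE.
    have [ix Ix] := rectangle_marginal_y mG e0 Ge (t *: delta_mx 0 i) (r *: delta_mx 0 j) x.
    split; first exact: (integrableZl measurableT s ix).
    by under eq_integral do rewrite EFinM; rewrite (integralZl measurableT ix) Ix mule0.
  - move=> y; rewrite uE vE.
    have [iy Iy] := rectangle_marginal_x mG e0 Ge (t *: delta_mx 0 i) (r *: delta_mx 0 j) y.
    split; first exact: (integrableZl measurableT s iy).
    by under eq_integral do rewrite EFinM; rewrite (integralZl measurableT iy) Iy mule0.
have ich := integrable_cost_mul mc cM ih.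
have icr := integrable_cost_mul mc cM irect.
have := hmin _ adm; rewrite /Ic.
have -> : (fun p => (c p * (h p + s * rectangle G u v p))%:E) =
          (fun p => (c p * h p)%:E + s%:E * (c p * rectangle G u v p)%:E)%E.
  by apply/funext => p; rewrite -EFinM -EFinD; congr (_%:E); ring.
rewrite (integralD measurableT ich (integrableZl measurableT s icr)).
rewrite (integralZl measurableT icr).
rewrite (integral_cost_rectangle mG e0 Ge mc cM).
pose D p := (c p - c (p + u) - c (p + v) + c (p + (u + v))) * \1_G p.
rewrite -[integral _ _ (fun p => (_ * \1_G p)%:E)]/(\int[lebR2n R d]_p (EFin \o D) p)%E.
have iD : (lebR2n R d).-integrable setT (EFin \o D).
  have [j0 _] := integral_cost_translated_indic mG e0 Ge mc cM 0.
  have [ju _] := integral_cost_translated_indic mG e0 Ge mc cM u.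
  have [jv _] := integral_cost_translated_indic mG e0 Ge mc cM v.
  have [juv _] := integral_cost_translated_indic mG e0 Ge mc cM (u + v).
  have := integrable_alternating _ j0 ju jv juv; congr (_.-integrable _ _).
  by apply/funext => p; congr (_%:E); rewrite addr0 /D; ring.
(* [- s] is a positive multiple of [k], and [k] times the mixed difference is positive on [G]. *)
have DG p : G p -> 0 < - s * D p.
  move=> Gp; rewrite /D indicE mem_set // mulr1 /s !mulNr opprK -mulrA mulrCA.
  have [Ep Eu Ev _] := GE p Gp.
  apply: mulr_gt0; first by rewrite !divr_gt0.
  rewrite addrA; move: Ep Eu Ev => /Em + /Em + /Em; rewrite mqe => qp qu qv.
  by apply: (mixed_difference_ball _ t0 r0 qp qu qv) => p' qp'; apply: good; rewrite mqe.
have D0 p : 0 <= - s * D p.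
  have [/DG/ltW //|Gp] := pselect (G p).
  by rewrite /D indicE memNset // !mulr0.
have mD : measurable_fun setT (fun p => - s * D p).
  have /integrableP[/measurable_EFinP mD _] := iD.
  by apply: measurable_funM => //; exact: measurable_cst.
have := integral_gt0_of_pos _ mD D0 mG posG DG.
under eq_integral do rewrite EFinM.
rewrite (integralZl measurableT iD).
(* Minimality says that [s] times the integral of [D] is nonnegative, against the positivity just
   obtained; finiteness of both integrals allows real arithmetic. *)
have := integrable_fin_num measurableT iD; have := integrable_fin_num measurableT ich.
rewrite /=; move: (integral _ _ _) (integral _ _ _) => a b.
case: a => [a| |] //; case: b => [b| |] // _ _; rewrite -!EFinM -?EFinD lte_fin lee_fin.
by move=> ? ?; lra.
Qed.

End minimizer.

(** * From null slack sets to geometric extremality *)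

Theorem theorem7p2 (R : realType) (d : nat)
    (c : Rvec R d * Rvec R d -> R) (hbar : Rvec R d * Rvec R d -> R)
    (f g : Rvec R d -> R) (h : Rvec R d * Rvec R d -> R) :
  (0 < d)%N ->
  (* c is continuous and satisfies (C1)-(C3) *)
  continuous c ->
  (exists M : R, forall p, `|c p| <= M) ->
  (exists Z : set (Rvec R d * Rvec R d),
      [/\ closed Z, (lebR2n R d).-negligible Z, C2_on (~` Z) c
        & forall p, ~ Z p -> \det (mixed_hessian c p) != 0]) ->
  (* 0 <= hbar in L^infinity with compact support *)
  {ae lebR2n R d, forall p, 0 <= hbar p} ->
  Linfty_c_R2d hbar ->
  (* 0 <= f, g in L^1_c *)
  {ae lebRn R d, forall x, 0 <= f x} -> L1c_Rd f ->
  {ae lebRn R d, forall y, 0 <= g y} -> L1c_Rd g ->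
  (* Gamma(f,g)^hbar is nonempty *)
  (exists h0, Gamma_bar f g hbar h0) ->
  (* h minimizes I_c over Gamma(f,g)^hbar *)
  Gamma_bar f g hbar h ->
  (forall h', Gamma_bar f g hbar h' -> (Ic c h <= Ic c h')%E) ->
  geom_extreme hbar h.
Proof.
move=> d0 cc [M cM] [Z [cZ nZ C2 nondeg]] hbar0 hbarL _ _ _ _ _ hG hmin.
have [[h0 [ih _] _ _] hhbar] := hG; have [mhbar _] := hbarL.
have mh : measurable_fun setT h by have /integrableP[/measurable_EFinP] := ih.
(* The contact set is itself Borel. Off it, [h] must be shown to vanish almost everywhere. *)
exists [set p | h p = hbar p]; split.
  exists [set p | h p = hbar p]; split; last first.
    by rewrite setDv setU0; exact: negligible_set0.
  rewrite (_ : [set p | _] = setT `&` (fun p => h p - hbar p) @^-1` [set 0]).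
    by apply: measurable_funB.
  rewrite setTI; apply/seteqP; split => p /=; first by move=> ->; rewrite subrr.
  by move/eqP; rewrite subr_eq0 => /eqP.
(* These countably many null sets exhaust the points where [0 < h p < hbar p]: take [1/(k+1)] below
   both [h p] and [hbar p - h p]. *)
pose N k := [set p | k.+1%:R^-1 <= h p] `&` [set p | k.+1%:R^-1 <= hbar p - h p].
have nN k : (lebR2n R d).-negligible (N k).
  have k0 : 0 < k.+1%:R^-1 :> R by [].
  apply/negligibleP; first last.
    exact: (minimizer_slack_null hbarL hG d0 cc cM cZ nZ C2 nondeg hmin k0).
  by apply: measurableI; apply: measurable_superlevel => //; exact: measurable_funB.
have noslack : {ae lebR2n R d, forall p, ~ (\bigcup_k N k) p}.
  by apply: negligibleS (negligible_bigcup nN) => p /= /contrapT.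
apply: filterS3 noslack h0 hhbar => p slackp h0p hbp.
have [hE|hE] := pselect (h p = hbar p); first by rewrite indicE mem_set // mulr1.
rewrite indicE memNset // mulr0; apply/eqP; rewrite eq_le h0p andbT leNgt.
apply/negP => hp; apply: slackp.
have hb : 0 < hbar p - h p.
  by rewrite subr_gt0 lt_neqAle hbp andbT; exact/eqP.
have [k] : exists k, 0 + k.+1%:R^-1 < Num.min (h p) (hbar p - h p).
  by apply: ltr_add_invr; rewrite lt_min hp.
by rewrite add0r lt_min => /andP[/ltW kh /ltW kb]; exists k.
Qed.
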